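(* Let $\mathcal{I}$ be a proper admissible ideal on $\mathbb{N}$. The smallest $\pi$-weight of a countable Tychonoff space that is not $\mathcal{I}$-H-separable is $\mathfrak{b}(\mathcal{I})$; that is, \[\min\{\pi w(X) : X \text{ is a countable Tychonoff space that is not } \mathcal{I}\text{-H-separable}\} = \mathfrak{b}(\mathcal{I}).\]
   Context: An ideal on $\mathbb{N}$ is a family of subsets of $\mathbb{N}$ closed under finite unions and under subsets; it is admissible if it contains every singleton and proper if it does not contain $\mathbb{N}$. A space $X$ is $\mathcal{I}$-H-separable if for every sequence $(Y_n)_{n\in\mathbb{N}}$ of dense subspaces of $X$ there is a sequence $(F_n)_{n\in\mathbb{N}}$ such that each $F_n$ is a finite subset of $Y_n$ and for every nonempty open set $U$ of $X$, $\{n\in\mathbb{N} : U\cap F_n=\emptyset\}\in\mathcal{I}$. A $\pi$-base of $X$ is a collection $\mathcal{B}$ of open sets such that every nonempty open set contains a nonempty member of $\mathcal{B}$; the $\pi$-weight $\pi w(X)$ is the least cardinality of a $\pi$-base of $X$. A set $S\subseteq\mathbb{N}^{\mathbb{N}}$ is $\mathcal{I}$-bounded if there is $g\in\mathbb{N}^{\mathbb{N}}$ such that $\{n\in\mathbb{N}: f(n)>g(n)\}\in\mathcal{I}$ for all $f\in S$, and $\mathcal{I}$-unbounded otherwise; $\mathfrak{b}(\mathcal{I})$ is the least cardinality of an $\mathcal{I}$-unbounded subset of $\mathbb{N}^{\mathbb{N}}$. *)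

(* Defs.v *)
From mathcomp Require Import all_boot.
From mathcomp Require Import boolp classical_sets functions cardinality.
From mathcomp Require Import topology urysohn.

Set Implicit Arguments.
Unset Strict Implicit.
Unset Printing Implicit Defensive.

Local Open Scope classical_set_scope.
Local Open Scope card_scope.

(* The first clause is closure under the empty union. *)
Definition is_ideal (I : set (set nat)) : Prop :=
  [/\ I set0,
      forall A B, I A -> I B -> I (A `|` B)
    & forall A B, A `<=` B -> I B -> I A].

Definition admissible (I : set (set nat)) : Prop := forall n, I [set n].

Definition proper_ideal (I : set (set nat)) : Prop := ~ I setT.

(* Cardinal numbers are represented by sets K : set T over arbitrary types and
   compared by #<= and #=; a class of cardinals is a predicate on such sets.
   least_cardinal C K says that C has a least element, of cardinality K. *)
Definition least_cardinal (C : forall T : Type, set T -> Prop)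
    (T : Type) (K : set T) : Prop :=
  (exists (U : Type) (L : set U), C U L /\ K #= L) /\
  (forall (U : Type) (L : set U), C U L -> K #<= L).

Definition cardinal_of_some (U : Type) (P : set U -> Prop)
    (T : Type) (K : set T) : Prop :=
  exists S : set U, P S /\ K #= S.

Definition I_H_separable (I : set (set nat)) (X : topologicalType) : Prop :=
  forall Y : nat -> set X, (forall n, dense (Y n)) ->
    exists F : nat -> set X,
      (forall n, finite_set (F n) /\ F n `<=` Y n) /\
      (forall U : set X, open U -> U !=set0 ->
         I [set n | U `&` F n = set0]).

Definition pi_base (X : topologicalType) (B : set (set X)) : Prop :=
  (forall V, B V -> open V) /\
  (forall U : set X, open U -> U !=set0 ->
     exists V, [/\ B V, V !=set0 & V `<=` U]).

Definition is_pi_weight (X : topologicalType) (T : Type) (K : set T) : Prop :=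
  least_cardinal (cardinal_of_some (@pi_base X)) K.

Definition I_bounded (I : set (set nat)) (S : set (nat -> nat)) : Prop :=
  exists g : nat -> nat, forall f, S f -> I [set n | (f n > g n)%N].

Definition is_b (I : set (set nat)) (T : Type) (K : set T) : Prop :=
  least_cardinal (cardinal_of_some (fun S => ~ I_bounded I S)) K.

Definition tychonoff_space (X : topologicalType) : Prop :=
  hausdorff_space X /\ completely_regular_space X.

Definition pi_weight_of_non_I_H_separable (I : set (set nat))
    (T : Type) (K : set T) : Prop :=
  exists X : topologicalType,
    [/\ countable [set: X], tychonoff_space X, ~ I_H_separable I X
      & is_pi_weight X K].

(* Main.v *)
Require Import Defs.
From mathcomp Require Import all_boot.
From mathcomp Require Import boolp classical_sets functions cardinality.
From mathcomp Require Import topology urysohn.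

Set Implicit Arguments.
Unset Strict Implicit.
Unset Printing Implicit Defensive.

Local Open Scope classical_set_scope.
Local Open Scope card_scope.

(** Write b for the least cardinality of an I-unbounded family, and fix an
    I-unbounded family S of that cardinality; it exists because the cardinals
    of subsets of a given type are well ordered. Two facts give the result.

    Lower bound ([card_pi_base_ge]). Let X be countable with a pi-base B of
    fewer than b sets, and let the Y_n be dense. Enumerate X and record, for
    each nonempty V in B, the function sending n to the rank of some point of
    V `&` Y_n. These are fewer than b functions, so a single g dominates them
    modulo I, and the points of Y_n of rank at most g n form finite sets
    witnessing I-H-separability. Hence every pi-base of a countable space that
    is not I-H-separable has at least b members.

    Sharpness. In the cube 2^S consider the points [sample_point n N p], whose
    f-th coordinate is 1 when f n < N and the first N values of f form one of
    the words listed in p. For fixed n these points are dense: a basic open set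
    constrains finitely many f in S, and for N large these f have f n < N and
    distinct words of length N, so p can select those required to be 1. The
    subspace X of all these points is countable, and Tychonoff as a subspace of
    a cube. Given a finite set F_n of points of the n-th layer for each n, let
    g n bound their parameters N. The open set where the f-th coordinate is 1
    misses F_n as soon as g n <= f n. If every nonempty open set met F_n for
    all n outside a set in I, every f in S would thus be dominated by g modulo
    I, contradicting unboundedness.

    The basic open sets of X are indexed by pairs of finite sequences in S.
    Since S is infinite, there are at most as many of these as elements of S
    ([infinite_card_seq2]), which rests on the classical fact that an infinite
    type T carries an injection of T * T into T ([infinite_pairing]). With the
    lower bound, the pi-weight of X is exactly b. *)

(** * Comparison of cardinals *)

(** The cardinals of the subsets of a type are well ordered. Grow a set G of
    selectors, each choosing an element from every member of P, two distinct
    selectors never agreeing on a member. If G is maximal, some S in P has all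
    its elements selected, for otherwise the missed elements would make up a
    new selector. Then G has as many elements as S, and evaluating G at any
    other member S' injects it into S'. *)
Lemma exists_least_card (U : pointedType) (P : set (set U)) :
  P !=set0 -> exists S, P S /\ forall S', P S' -> S #<= S'.
Proof.
move=> [S1 PS1].
pose Q (G : set (set U -> U)) :=
  (forall f S, G f -> P S -> S (f S)) /\
  (forall f g S, G f -> G g -> P S -> f S = g S -> f = g).
have [F FQ Ftot|G [[Gsel Ginj] Gmax]] := @Zorn_bigcup _ Q.
  split=> [f S [X FX Xf] PS|f g S [X FX Xf] [Y FY Yg] PS].
    by have [sel _] := FQ _ FX; exact: sel Xf PS.
  have [XY|YX] := Ftot _ _ FX FY.
  - by have [_ inj] := FQ _ FY; apply: inj => //; exact: XY.
  - by have [_ inj] := FQ _ FX; apply: inj => //; exact: YX.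
have [[S [PS GS]]|noS] :=
    pselect (exists S, P S /\ S `<=` [set f S | f in G]); last first.
  have : forall S, exists u, P S -> S u /\ forall f, G f -> f S <> u.
    move=> S; have [PS|nPS] := pselect (P S); last by exists point.
    apply: contrapT => nu; apply: noS; exists S; split=> // u Su.
    apply: contrapT => nGu; apply: nu; exists u => _; split=> // f Gf fSu.
    by apply: nGu; exists f.
  (* h picks from each member of P an element missed by all of G *)
  move=> /choice[h hP]; exfalso.
  apply: (Gmax (G `|` [set h]) _ _).
    split=> [|/(_ h (or_intror erefl)) Gh]; first by move=> f; left.
    by have [_ /(_ _ Gh)] := hP _ PS1.
  split=> [f S [Gf PS|-> PS]|f g S]; [exact: Gsel Gf PS|by have [] := hP _ PS|].
  move=> [Gf|->] [Gg|->] PS //; first exact: Ginj.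
  - by have [_ /(_ _ Gf)] := hP _ PS.
  - by have [_ /(_ _ Gg) + /esym] := hP _ PS.
exists S; split=> // S' PS'.
apply: card_le_trans (subset_card_le GS) _.
apply: card_le_trans (card_image_le _ _) _.
apply/pcard_leP/injfunPex; exists (fun f => f S').
  by move=> f Gf; exact: Gsel Gf PS'.
by move=> f g; rewrite !inE => Gf Gg; exact: Ginj.
Qed.

Lemma card_le_total (T : pointedType) (A B : set T) : (A #<= B) \/ (B #<= A).
Proof.
have [|S [[->|->] Sle]] := @exists_least_card T [set S | S = A \/ S = B].
- by exists A; left.
- by left; apply: Sle; right.
- by right; apply: Sle; left.
Qed.

(** The seed G0 replaces the empty chain, which would otherwise ask P of the
    empty set; maximality among supersets of G0 is then maximality in P. *)
Lemma Zorn_bigcup_above (T : Type) (P : set (set T)) (G0 : set T) :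
  P G0 ->
  (forall F, F !=set0 -> F `<=` P -> total_on F subset ->
    P (\bigcup_(X in F) X)) ->
  exists A, [/\ G0 `<=` A, P A & forall B, A `<` B -> ~ P B].
Proof.
move=> PG0 Pchain.
have [F FP Ftot|A [PA Amax]] := @Zorn_bigcup _ [set X | P (G0 `|` X)].
  have [->|/set0P[X0 FX0]] := eqVneq F set0.
    by rewrite bigcup_set0 /= setU0.
  rewrite /=; have -> : G0 `|` \bigcup_(X in F) X =
      \bigcup_(X in [set G0 `|` X | X in F]) X.
    rewrite bigcup_image; apply/seteqP.
    split=> [x [G0x|[X FX Xx]]|x [X FX [G0x|Xx]]].
    - by exists X0 => //; left.
    - by exists X => //; right.
    - by left.
    - by right; exists X.
  apply: Pchain; first by exists (G0 `|` X0), X0.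
    by move=> _ [X FX <-]; exact: FP.
  move=> _ _ [X FX <-] [Y FY <-].
  by have [XY|YX] := Ftot _ _ FX FY; [left|right]; exact: setUS.
exists (G0 `|` A); split=> // B [AB nBA] PB.
have G0B : G0 `<=` B by move=> x G0x; apply: AB; left.
apply: (Amax B _ _); last by rewrite /= (setUidr G0B).
by split=> [x Ax|BA]; [apply: AB; right|apply: nBA => x /BA; right].
Qed.

(** * Pairing functions on infinite types *)

Section Pairing.
Context {T : Type}.
Implicit Types G : set (T * T * T).

(** A partial pairing function on T is handled as its graph, so that unions of
    chains are plain unions. Its domain is the square of a subset of T that is
    read off from the diagonal. *)
Definition diag_support G : set T := [set a | exists c, G (a, a, c)].

(** A pair may be related to several values: by the third clause, every
    selection among them is injective. *)
Definition pairing_graph G : Prop :=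
  [/\ forall a b, diag_support G a -> diag_support G b -> exists c, G (a, b, c),
      forall a b c, G (a, b, c) ->
        [/\ diag_support G a, diag_support G b & diag_support G c]
    & forall a b a' b' c, G (a, b, c) -> G (a', b', c) -> a = a' /\ b = b'].

Lemma diag_supportS G G' : G `<=` G' -> diag_support G `<=` diag_support G'.
Proof. by move=> GG' a [c /GG' ?]; exists c. Qed.

Lemma pairing_graph_bigcup (F : set (set (T * T * T))) :
  F `<=` pairing_graph -> total_on F subset ->
  pairing_graph (\bigcup_(G in F) G).
Proof.
move=> Fpair Ftot; split.
- move=> a b [c [X FX Xac]] [d [Y FY Ybd]].
  have [XY|YX] := Ftot _ _ FX FY.
    have [/(_ a b) tot _ _] := Fpair _ FY.
    have [||e Ye] := tot; [by exists c; exact: XY|by exists d|].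
    by exists e, Y.
  have [/(_ a b) tot _ _] := Fpair _ FX.
  have [||e Xe] := tot; [by exists c|by exists d; exact: YX|].
  by exists e, X.
- move=> a b c [X FX Xabc]; have [_ /(_ _ _ _ Xabc)[? ? ?] _] := Fpair _ FX.
  have XF : X `<=` \bigcup_(G in F) G by move=> z Xz; exists X.
  by split; apply: (diag_supportS XF).
- move=> a b a' b' c [X FX Xabc] [Y FY Yabc].
  have [XY|YX] := Ftot _ _ FX FY.
    by have [_ _] := Fpair _ FY; apply; [exact: XY Xabc|].
  by have [_ _] := Fpair _ FX; apply; [exact: Xabc|exact: YX].
Qed.

Lemma pairing_graph_nat (e : nat -> T) : injective e ->
  pairing_graph [set (e ij.1, e ij.2, e (pickle ij)) | ij in setT].
Proof.
move=> einj; set G := [set _ | _ in _].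
have suppG i : diag_support G (e i).
  by exists (e (pickle (i, i))), (i, i).
have Gsupp a : diag_support G a -> exists i, a = e i.
  by move=> [c [[i j] _ [<- _ _]]]; exists i.
split.
- move=> a b /Gsupp[i ->] /Gsupp[j ->].
  by exists (e (pickle (i, j))), (i, j).
- by move=> a b c [[i j] _ [<- <- <-]].
- move=> a b a' b' c [[i j] _ [<- <- <-]] [[k l] _ [<- <-]] /einj.
  by move=> /(pcan_inj pickleK)[-> ->].
Qed.

Lemma pairing_graph_fun G : pairing_graph G -> exists phi : T -> T -> T,
  [/\ forall a b, diag_support G a -> diag_support G b -> G (a, b, phi a b),
      forall a b, diag_support G a -> diag_support G b ->
        diag_support G (phi a b)
    & forall a b a' b', diag_support G a -> diag_support G b ->
        diag_support G a' -> diag_support G b' ->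
        phi a b = phi a' b' -> a = a' /\ b = b'].
Proof.
move=> [tot supp inj].
have : forall ab : T * T, exists c,
    diag_support G ab.1 -> diag_support G ab.2 -> G (ab.1, ab.2, c).
  move=> [a b] /=.
  have [[Ga Gb]|nG] := pselect (diag_support G a /\ diag_support G b).
    by have [c] := tot _ _ Ga Gb; exists c.
  by exists a => Ga Gb; case: nG.
move=> /choice[phi phiP]; exists (fun a b => phi (a, b)).
have {}phiP a b : diag_support G a -> diag_support G b -> G (a, b, phi (a, b)).
  exact: (phiP (a, b)).
split=> // [a b Ga Gb|a b a' b' Ga Gb Ga' Gb' eq_phi].
  by have [] := supp _ _ _ (phiP _ _ Ga Gb).
by apply: inj (phiP _ _ Ga Gb) _; rewrite eq_phi; exact: phiP.
Qed.

(** Let B be the support of G. A copy of B disjoint from B, given by j, allows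
    G to be extended to the union of B and its copy: the three new blocks of
    the enlarged square are each indexed by B * B, hence by B, and [phi] applied
    to a tag in B keeps their values apart inside the copy of B. *)
Lemma pairing_graph_extend G (e : nat -> T) (j : T -> T) :
  pairing_graph G -> injective e -> (forall i, diag_support G (e i)) ->
  (forall a, diag_support G a -> ~ diag_support G (j a)) ->
  (forall a b, diag_support G a -> diag_support G b -> j a = j b -> a = b) ->
  exists G', G `<` G' /\ pairing_graph G'.
Proof.
move=> Gp einj suppe jC jinj.
have [phi [phiP suppphi phi_inj]] := pairing_graph_fun Gp.
have [_ Gsupp Ginj] := Gp.
pose emb (t : bool) a := if t then j a else a.
(* the blocks of the enlarged square are numbered in binary by s and t *)
pose tag (s t : bool) := e (s + t.*2).
pose H : set (T * T * T) := [set x | exists s t a b,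
  [/\ s || t, diag_support G a, diag_support G b &
      x = (emb s a, emb t b, j (phi (tag s t) (phi a b)))]].
have supp_emb t a : diag_support G a -> diag_support (G `|` H) (emb t a).
  case: t => [Ga|]; last by apply: diag_supportS; left.
  exists (j (phi (tag true true) (phi a a))); right.
  by exists true, true, a, a.
have emb_supp x : diag_support (G `|` H) x ->
    exists t a, diag_support G a /\ x = emb t a.
  move=> [c [Gxc|[s [t [a [b [_ Ga _ [-> _ _]]]]]]]].
    by exists false, x; split=> //; exists c.
  by exists s, a.
exists (G `|` H); split.
  split=> [x Gx|HG]; first by left.
  apply: (jC (e 0)) => //.
  have [d [|Hd]] := supp_emb true (e 0) (suppe 0); first by exists d.
  by exists d; apply: HG; right.
split.
- move=> x y /emb_supp[s [a [Ga ->]]] /emb_supp[t [b [Gb ->]]].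
  have [st|] := boolP (s || t).
    by exists (j (phi (tag s t) (phi a b))); right; exists s, t, a, b.
  rewrite negb_or => /andP[/negPf-> /negPf->].
  by exists (phi a b); left; exact: phiP.
- move=> x y c [Gxyc|[s [t [a [b [_ Ga Gb [-> -> ->]]]]]]].
    have [] := Gsupp _ _ _ Gxyc.
    by move=> ? ? ?; split; apply: diag_supportS; try eassumption; left.
  split; [exact: supp_emb|exact: supp_emb|].
  by apply: (supp_emb true); apply: (suppphi); [exact: suppe|exact: suppphi].
- (* values of G lie in its support, values of H in the copy *)
  have excl x y a b s t : diag_support G a -> diag_support G b ->
      G (x, y, j (phi (tag s t) (phi a b))) -> False.
    move=> Ga Gb /Gsupp[_ _]; apply: jC.
    by apply: (suppphi); [exact: suppe|exact: suppphi].
  move=> x y x' y' c.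
  move=> [Gc|[s [t [a [b [_ Ga Gb [-> -> ->]]]]]]]
    [Gc'|[s' [t' [a' [b' [_ Ga' Gb' [-> ->]]]]]]].
  + exact: Ginj Gc Gc'.
  + by move=> cE; move: Gc; rewrite cE => /excl[].
  + by have [] := excl _ _ _ _ _ _ Ga Gb Gc'.
  + have supp2 := suppphi _ _ Ga Gb; have supp2' := suppphi _ _ Ga' Gb'.
    move=> /jinj -/(_ (suppphi _ _ (suppe _) supp2)
                     (suppphi _ _ (suppe _) supp2')).
    move=> /phi_inj -/(_ (suppe _) supp2 (suppe _) supp2')[/einj st].
    move=> /phi_inj -/(_ Ga Gb Ga' Gb')[-> ->].
    by case: s s' t t' st => -[] [] [].
Qed.

End Pairing.

(** A maximal pairing graph above a countable one has a support B to which no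
    disjoint copy of B can be added. So the complement of B injects into B,
    whence T itself injects into B, and the pairing of B transfers to T. *)
Lemma infinite_pairing (T : Type) : infinite_set [set: T] ->
  exists phi : T -> T -> T,
    forall a b a' b', phi a b = phi a' b' -> a = a' /\ b = b'.
Proof.
elim/Ppointed: T => T; first by move=> []; rewrite emptyE; exact: finite_set0.
move=> /infiniteP /pcard_leTP/injPex[e /in2TT einj].
have [F _ Fpair Ftot|G [G0G Gp Gmax]] :=
    Zorn_bigcup_above (pairing_graph_nat einj).
  exact: pairing_graph_bigcup.
have suppe i : diag_support G (e i).
  by apply: (diag_supportS G0G); exists (e (pickle (i, i))), (i, i).
have [BC|CB] := card_le_total (diag_support G) (~` diag_support G).
  have /pcard_leP/injfunPex[j jC jinj] := BC.
  have [||G' [GG' G'p]] := @pairing_graph_extend _ G e j Gp einj suppe.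
  - exact: jC.
  - by move=> a b Ga Gb; apply: jinj; rewrite inE.
  - by case: (Gmax _ GG' G'p).
have /pcard_leP/injfunPex[j jB jinj] := CB.
have [phi [_ suppphi phi_inj]] := pairing_graph_fun Gp.
have Gj z : z \notin diag_support G -> diag_support G (j z).
  by move=> /negP nGz; apply: jB => Gz; apply: nGz; rewrite inE.
have [c csupp cinj] : exists2 c : T -> T,
    forall x, diag_support G (c x) & injective c.
  (* the tags e 0 and e 1 separate B from its complement *)
  pose c x := if x \in diag_support G then phi (e 0) x else phi (e 1) (j x).
  exists c => [x|x y]; rewrite /c.
    case: ifPn => [/set_mem Gx|/Gj Gjx]; exact: suppphi.
  case: ifPn => [/set_mem Gx|Gx]; case: ifPn => [/set_mem Gy|Gy].
  - by move=> /phi_inj -/(_ (suppe 0) Gx (suppe 0) Gy)[].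
  - by move=> /phi_inj -/(_ (suppe 0) Gx (suppe 1) (Gj _ Gy))[/einj].
  - by move=> /phi_inj -/(_ (suppe 1) (Gj _ Gx) (suppe 0) Gy)[/einj].
  - move=> /phi_inj -/(_ (suppe 1) (Gj _ Gx) (suppe 1) (Gj _ Gy))[_].
    by apply: jinj; rewrite in_setC.
exists (fun a b => phi (c a) (c b)) => a b a' b'.
by move=> /phi_inj -/(_ (csupp _) (csupp _) (csupp _) (csupp _))[/cinj->]/cinj.
Qed.

(** A sequence is coded by its length and its iterated pairing; once the length
    is known, the code can be unfolded entry by entry. *)
Lemma infinite_card_seq2 (T : Type) : infinite_set [set: T] ->
  [set: seq T * seq T] #<= [set: T].
Proof.
move=> Tinf; have [phi phi_inj] := infinite_pairing Tinf; move: Tinf.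
elim/Ppointed: T phi phi_inj => T phi phi_inj.
  by move=> []; rewrite emptyE; exact: finite_set0.
move=> /infiniteP /pcard_leTP/injPex[e /in2TT einj].
pose code (s : seq T) := phi (e (size s)) (foldr phi point s).
have code_inj : injective code.
  move=> s t /phi_inj[/einj + ]; rewrite /code {code}.
  elim: s t => [|a s IH] [|b t] //= [st] /phi_inj[-> ft].
  by rewrite (IH _ st ft).
apply/pcard_injP; exists (fun st => phi (code st.1) (code st.2)).
by move=> [s t] [s' t'] _ _ /phi_inj /= [/code_inj-> /code_inj->].
Qed.

(** * The lower bound *)

Lemma card_pi_base_ge (I : set (set nat)) (S : set (nat -> nat))
    (X : topologicalType) (B : set (set X)) :
  is_ideal I ->
  (forall S', ~ I_bounded I S' -> S #<= S') ->
  countable [set: X] -> ~ I_H_separable I X -> pi_base B ->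
  S #<= B.
Proof.
move=> [_ _ Isub] Smin /countable_injP[idx /in2TT idx_inj] XnH [Bop Bpi].
apply: contrapT => nSB; apply: XnH => Y Ydense.
(* f gives the ranks of points of V in the successive Y n *)
have : forall V : set X, exists f : nat -> nat, B V -> V !=set0 ->
    forall n, exists2 x, (V `&` Y n) x & idx x = f n.
  move=> V; have [[BV V0]|nBV] := pselect (B V /\ V !=set0); last first.
    by exists (fun=> 0) => BV V0; case: nBV.
  have : forall n, exists k, exists2 x, (V `&` Y n) x & idx x = k.
    by move=> n; have [x Vx] := Ydense n V V0 (Bop _ BV); exists (idx x), x.
  by move=> /choice[f fP]; exists f.
move=> /choice[h hP].
have [g gP] : I_bounded I (h @` B).
  apply: contrapT => /Smin Sle; apply: nSB.
  exact: card_le_trans Sle (card_image_le _ _).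
exists (fun n => [set x | Y n x /\ (idx x <= g n)%N]); split.
  move=> n; split=> [|x []//].
  apply/finite_set_leP; exists (g n).+1.
  by apply/pcard_leP/injfunPex; exists idx => [x []//|x y _ _ /idx_inj].
move=> U Uop U0; have [V [BV V0 VU]] := Bpi _ Uop U0.
apply: Isub (gP (h V) _); last by exists V.
move=> n /= UF0; rewrite ltnNge; apply/negP => hg.
have [x [Vx Yx] xE] := hP _ BV V0 n.
suff : set0 x by [].
by rewrite -UF0; split; [exact: VU|split=> //; rewrite xE].
Qed.

(** The uniformity of T itself separates: some entourage has a section at x
    that misses B. *)
Lemma completely_regular_of_uniform (T : uniformType) :
  completely_regular_space T.
Proof.
move=> x B Bcl nBx.
have : nbhs x (~` B).
  by apply: open_nbhs_nbhs; split=> //; exact: closed_openC.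
rewrite -nbhs_entourageE => -[E Eent EB].
exists (Uniform.class T), E; split=> //; last by move=> ?; exact: subset_refl.
rewrite -subset0 => -[y z] [[/= -> Bz] /xsectionP Exz].
exact: (EB z).
Qed.

(** * A countable space built from an unbounded family *)

Section SampleSpace.
Variable S : set (nat -> nat).

Let coord : choiceType := set_type S.
Let cube := {ptws coord -> bool}.

(** The cutoff f n < N keeps the f-th coordinate at 0 on points of layer n with
    a small parameter N, which defeats finite selections; the words in p let
    finitely many coordinates be prescribed, which gives density. *)
Definition sample_point (n N : nat) (p : seq (seq nat)) : cube :=
  fun f => (val f n < N)%N && (mkseq (val f) N \in p).

Definition sample_set : set cube :=
  range (fun i : nat * nat * seq (seq nat) => sample_point i.1.1 i.1.2 i.2).

Definition sample_space : topologicalType := set_type sample_set.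
Let sample_uspace : uniformType := set_type sample_set.

Lemma nbhs_cube (x : cube) (W : set cube) : nbhs x W ->
  exists s : seq coord, forall g : cube, {in s, g =1 x} -> W g.
Proof.
(* F is the filter of the neighbourhoods of x given by finitely many
   coordinates; it converges to x because each coordinate does *)
pose F : set_system cube :=
  [set W | exists s : seq coord, forall g : cube, {in s, g =1 x} -> W g].
have FF : Filter F.
  split.
  - by exists [::].
  - move=> A B [s sA] [t tB]; exists (s ++ t) => g gx.
    by split; [apply: sA|apply: tB] => f fs; apply: gx;
      rewrite mem_cat fs ?orbT.
  - by move=> A B AB [s sA]; exists s => g /sA /AB.
suff : F --> x by move=> /(_ W) + xW; exact.
apply/cvg_sup => f A [_ [[C _ <-] Cx CA]].
by exists [:: f] => g gx; apply: CA; rewrite /= gx ?mem_head.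
Qed.

Lemma nbhs_sample_space (x : sample_space) (U : set sample_space) :
  open U -> U x ->
  exists s : seq coord,
    forall y : sample_space, {in s, val y =1 val x} -> U y.
Proof.
move=> Uop Ux; have : nbhs x U by apply: open_nbhs_nbhs.
move=> [_ [[W Wop <-] /= Wx WU]].
have [s sW] := nbhs_cube (open_nbhs_nbhs (conj Wop Wx)).
by exists s => y yx; apply: WU; exact: sW.
Qed.

Lemma continuous_set_val : continuous (set_val : sample_space -> cube).
Proof. exact: initial_continuous. Qed.

Lemma open_coord (f : coord) (P : pred bool) :
  open [set x : sample_space | P (val x f)].
Proof.
have cp : continuous (fun g : cube => g f).
  exact: (@proj_continuous coord (fun=> bool) f).
suff : continuous (fun x : sample_space => val x f).
  by move=> /continuousP /(_ [set` P]); apply; exact: discrete_open.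
by move=> x; apply: (@continuous_comp sample_space cube _ set_val _ x
  (@continuous_set_val x) (cp _)).
Qed.

Definition sample_box (p : seq coord * seq coord) : set sample_space :=
  [set x | all (val x) p.1 && all (predC (val x)) p.2].

Lemma open_sample_box p : open (sample_box p).
Proof.
have all_open (P : pred bool) (s : seq coord) :
    open [set x : sample_space | all (fun f => P (val x f)) s].
  elim: s => [|f s IH] /=.
    by rewrite (_ : mkset _ = setT) ?predeqE//; exact: openT.
  rewrite (_ : mkset _ = [set x : sample_space | P (val x f)] `&`
      [set x : sample_space | all (fun f => P (val x f)) s]).
    by apply: openI => //; exact: open_coord.
  by apply/seteqP; split=> x /= => [/andP[]|[-> ->]].
rewrite (_ : sample_box p =
    [set x : sample_space | all (fun f => val x f) p.1] `&`
    [set x : sample_space | all (fun f => ~~ val x f) p.2]).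
  by apply: openI; [exact: (all_open id)|exact: (all_open negb)].
by apply/seteqP; split=> x /= => [/andP[]|[? ?]] //; apply/andP.
Qed.

Lemma pi_base_sample_box : pi_base (range sample_box).
Proof.
split=> [_ [p _ <-]|U Uop [x Ux]]; first exact: open_sample_box.
have [s sU] := nbhs_sample_space Uop Ux.
exists (sample_box ([seq f <- s | val x f], [seq f <- s | ~~ val x f])).
split; [by eexists|exists x|move=> y].
  apply/andP; split; first exact: filter_all.
  exact: filter_all.
move=> /andP[/allP yT /allP yF]; apply: sU => f fs.
have [xf|/negbTE xf] := boolP (val x f).
  by apply: yT; rewrite mem_filter xf.
by apply/negbTE; apply: (yF f); rewrite mem_filter xf.
Qed.

Definition sample (n N : nat) (p : seq (seq nat)) : sample_space :=
  SigSub (mem_set (imageT _ (n, N, p) : sample_set (sample_point n N p))).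

Definition sample_layer (n : nat) : set sample_space :=
  [set x | exists N p, x = sample n N p].

(** Once M bounds the values at n of the constrained functions and the places
    where any two of them differ, their words of length M.+1 are distinct, and
    p may list exactly those of the functions whose coordinate must be 1. *)
Lemma dense_sample_layer n : dense (sample_layer n).
Proof.
move=> U [x Ux] Uop; have [s sU] := nbhs_sample_space Uop Ux.
have : forall fg : coord * coord, exists k,
    fg.1 <> fg.2 -> val fg.1 k <> val fg.2 k.
  move=> [f g] /=; have [->|/eqP nfg] := eqVneq f g; first by exists 0.
  apply: contrapT => /forallNP eq_fg; apply: nfg; apply: val_inj.
  by apply: funext => k; apply: contrapT => fgk; apply: (eq_fg k).
move=> /choice[d dP].
pose w f := maxn (val f n) (\max_(g <- s) d (f, g)).
pose M := \max_(f <- s) w f.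
have wM f : f \in s -> w f <= M by move=> fs; exact: leq_bigmax_seq.
have sM f : f \in s -> val f n < M.+1.
  by move=> /wM; rewrite geq_max ltnS => /andP[].
have dM f g : f \in s -> g \in s -> d (f, g) < M.+1.
  move=> /wM; rewrite geq_max => /andP[_ dM] gs; rewrite ltnS.
  apply: leq_trans dM.
  exact: (leq_bigmax_seq (F := fun g => d (f, g)) g gs isT).
pose p := [seq mkseq (val f) M.+1 | f <- s & val x f].
exists (sample n M.+1 p); split; last by exists M.+1, p.
apply: sU => f fs; rewrite /= /sample_point sM //=.
have [xf|xf] := boolP (val x f).
  by apply: map_f; rewrite mem_filter xf.
apply/negbTE/mapP => -[g]; rewrite mem_filter => /andP[xg gs] fg.
have dfg : val f (d (f, g)) <> val g (d (f, g)).
  by apply: (dP (f, g)) => /= fE; move: xf; rewrite fE xg.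
apply: dfg; have := congr1 (nth 0 ^~ (d (f, g))) fg.
by rewrite !nth_mkseq ?dM.
Qed.

Lemma hausdorff_sample_space : hausdorff_space sample_space.
Proof.
have hc : hausdorff_space cube.
  apply: hausdorff_product => _; exact: discrete_hausdorff.
move=> x y xy; apply: val_inj; apply: hc.
move=> A B xA yB.
have [z [Az Bz]] := xy _ _ (continuous_set_val xA) (continuous_set_val yB).
by exists (set_val z).
Qed.

Lemma tychonoff_sample_space : tychonoff_space sample_space.
Proof.
split; first exact: hausdorff_sample_space.
exact: (@completely_regular_of_uniform sample_uspace).
Qed.

Lemma countable_sample_space : countable [set: sample_space].
Proof.
rewrite /countable (card_le_eql (card_setT _)).
apply: card_le_trans (card_image_le _ _) _; exact: countableP.
Qed.

Lemma sample_space_not_I_H_separable I :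
  is_ideal I -> ~ I_bounded I S -> ~ I_H_separable I sample_space.
Proof.
move=> [_ _ Isub] Sunb /(_ _ dense_sample_layer)[F [Ffin Fmeets]].
apply: Sunb.
have : forall n, exists m, forall x, F n x ->
    exists N p, (N <= m)%N /\ x = sample n N p.
  move=> n; have [/finite_seqP[s Fs] Fn] := Ffin n.
  have : forall x, exists N, F n x -> exists p, x = sample n N p.
    move=> x; have [/Fn[N [p ->]]|nFx] := pselect (F n x).
      by exists N => _; exists p.
    by exists 0.
  move=> /choice[N NP]; exists (\max_(x <- s) N x) => x Fx.
  have [p xE] := NP x Fx; exists (N x), p; split=> //.
  by rewrite leq_bigmax_seq//; move: Fx; rewrite Fs.
move=> /choice[g gP]; exists g => f Sf.
pose f' : coord := SigSub (mem_set Sf).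
have Uop : open [set x : sample_space | val x f'] := open_coord f' id.
apply: Isub (Fmeets _ Uop _).
  move=> n /= gf; rewrite -subset0 => x [xf /gP[N [p [Ng xE]]]].
  move: xf; rewrite xE /= /sample_point /= => /andP[fN _].
  by move: (leq_trans fN (leq_trans Ng (ltnW gf))); rewrite ltnn.
exists (sample 0 (f 0).+1 [:: mkseq f (f 0).+1]).
by rewrite /= /sample_point /= ltnSn mem_seq1 eqxx.
Qed.

End SampleSpace.

(** * The smallest pi-weight *)

Lemma I_unbounded_infinite I S :
  is_ideal I -> ~ I_bounded I S -> infinite_set S.
Proof.
move=> [I0 _ Isub] Sunb /finite_seqP[s Ss]; apply: Sunb.
exists (fun n => \max_(f <- s) f n) => f; rewrite Ss /= => fs.
apply: Isub I0 => n /=; rewrite ltnNge => /negP; apply.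
exact: (leq_bigmax_seq (F := fun f : nat -> nat => f n) f fs isT).
Qed.

Theorem corollary3p21 (I : set (set nat)) (hI : is_ideal I)
    (hadm : admissible I) (hprop : proper_ideal I) :
  exists (T : Type) (kappa : set T),
    is_b I kappa /\
    least_cardinal (pi_weight_of_non_I_H_separable I) kappa.
Proof.
have [|S [Sunb Smin]] := @exists_least_card _ [set S | ~ I_bounded I S].
  exists setT => -[g /(_ (fun n => (g n).+1) Logic.I)]; apply: contra_not hprop.
  by rewrite (_ : mkset _ = setT) // predeqE => n; split=> // _ /=.
have Sinf : infinite_set [set: S].
  by rewrite (eq_finite_set (card_setT S)); exact: I_unbounded_infinite Sunb.
exists (nat -> nat), S; split.
  split; first by exists (nat -> nat), S; split=> //; exists S; split.
  by move=> U L [S' [/Smin SS' LS']]; rewrite (card_le_eqr LS').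
have XnH := sample_space_not_I_H_separable hI Sunb.
have cX := countable_sample_space S.
split; last first.
  move=> U L [X [Xc _ XH [[V [W [[B [Bpi WB]] LW]] _]]]].
  rewrite (card_le_eqr (card_eq_trans LW WB)).
  exact: (card_pi_base_ge hI Smin Xc XH Bpi).
exists (nat -> nat), S; split=> //; exists (sample_space S); split=> //.
  exact: tychonoff_sample_space.
split.
  exists (set (sample_space S)), (range (@sample_box S)); split.
    by exists (range (@sample_box S)); split=> //; exact: pi_base_sample_box.
  rewrite card_eq_le; apply/andP; split.
    exact: (card_pi_base_ge hI Smin cX XnH (@pi_base_sample_box S)).
  apply: card_le_trans (card_image_le _ _) _.
  rewrite -(card_le_eqr (card_setT S)).
  exact: infinite_card_seq2 Sinf.
move=> U L [B [Bpi LB]]; rewrite (card_le_eqr LB).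
exact: (card_pi_base_ge hI Smin cX XnH Bpi).
Qed.
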